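(* Let $m$ be a positive integer and, for an integer $N \ge 0$, put $f(N) = \lceil N/m \rceil$. The Chocolate Stones game with parameter $m$ is a no-strategy game: for every starting pile size $N \ge 0$, every sequence of legal moves played until no move is available results in the same winner, regardless of the choices made by the players. Moreover, for every $N \ge 0$, the pile of $N$ stones is a P-position if and only if $f(N)$ is even.
   Context: Chocolate Stones game with parameter $m$: a position is a pile of $N \ge 0$ stones. Two players alternate moves. If $N>0$ is not divisible by $m$, let $a \in \{1,\dots,m-1\}$ be the remainder of $N$ modulo $m$; the player to move may remove any number $s$ of stones with $a \le s \le m$ (and, of course, $s \le N$). If $N > 0$ is divisible by $m$, the player to move must remove exactly $m$ stones. There is no move from $N=0$. A player who has no move loses. A P-position is a position from which the previous player (the player who is not about to move) wins under perfect play; an N-position is a position from which the next player (the one about to move) wins under perfect play. A no-strategy game is one in which the winner is determined by the starting position alone, independently of how the players move. *)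

(* Defs.v *)
From mathcomp Require Import all_boot all_order all_algebra.

Set Implicit Arguments.
Unset Strict Implicit.
Unset Printing Implicit Defensive.

Definition legal_removal (m N s : nat) : bool :=
  (0 < N) &&
  (if m %| N then s == m else [&& N %% m <= s, s <= m & s <= N]).

Definition move (m : nat) : rel nat :=
  fun N N' => (N' <= N) && legal_removal m N (N - N').

Definition terminal (m N : nat) : Prop := forall N', ~~ move m N N'.

(* A play from N is recorded as the sequence of successive positions after N,
   so its size is the number of moves made. *)
Definition complete_play (m N : nat) (p : seq nat) : Prop :=
  path (move m) N p /\ terminal m (last N p).

(* For m > 0 every play is therefore finite, and it is enough to consider
   complete plays. *)
Lemma move_lt (m N N' : nat) : 0 < m -> move m N N' -> N' < N.
Proof.
move=> m_gt0 /andP[leN'N /andP[_]]; rewrite -subn_gt0.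
case: ifPn => [_ /eqP-> //|mN /and3P[le_a _ _]].
by apply: leq_trans le_a; rewrite lt0n.
Qed.

(* Next is the player about to move at the starting position. *)
Inductive player := Next | Previous.

Definition opponent (P : player) : player :=
  match P with Next => Previous | Previous => Next end.

(* The player to move once k moves have been made. *)
Definition mover (k : nat) : player := if odd k then Previous else Next.

(* In a complete play, the player left to move has no move and loses. *)
Definition winner (p : seq nat) : player := opponent (mover (size p)).

Definition no_strategy (m : nat) : Prop :=
  forall N, exists w, forall p, complete_play m N p -> winner p = w.

Definition legal_strategy (m : nat) (sigma : nat -> nat) : Prop :=
  forall N, ~ terminal m N -> move m N (sigma N).

Definition follows (P : player) (sigma : nat -> nat) (N : nat) (p : seq nat) :
    Prop :=
  forall i, i < size p -> mover i = P ->
    nth 0 (N :: p) i.+1 = sigma (nth 0 (N :: p) i).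

(* Winning under perfect play is having a strategy that wins against all
   play of the opponent. *)
Definition wins_under_perfect_play (m : nat) (P : player) (N : nat) : Prop :=
  exists sigma, legal_strategy m sigma /\
    forall p, complete_play m N p -> follows P sigma N p -> winner p = P.

Definition P_position (m N : nat) : Prop :=
  wins_under_perfect_play m Previous N.

Definition f (m N : nat) : int := Num.ceil (N%:R / m%:R : rat)%R.

(* Main.v *)
Require Import Defs.
From mathcomp Require Import all_boot all_order all_algebra.
From mathcomp Require Import zify.

(** Cut the positive integers into blocks of [m] consecutive numbers, so that
    [N] lies in block number [ceil (N / m)] and [0] forms block [0].  If
    [N = q * m + a] with [0 < a < m], the removal of [s] stones, [a <= s <= m],
    leaves a number between [(q - 1) * m + a] and [q * m], inside the block just
    below; when [q = 0] the bound [s <= N] forces [s = a], and the pile is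
    emptied.  If [m] divides [N], removing [m] stones also descends exactly one
    block.  So every legal move lowers the block number by one
    ([move_ceil_div]), and since a nonempty pile always admits a move
    ([move_lower]), every complete play from [N] has exactly [ceil (N / m)]
    moves ([size_complete_play]).  The parity of this number alone decides the
    winner.

    Passing from plays to P-positions takes two more remarks.  When the
    parity is even, any legal strategy wins for the previous player, and
    removing the least legal number of stones is one.  When it is odd, a
    strategy for the previous player could only be winning vacuously, if no
    complete play followed it; but letting both players use it produces such a
    play ([complete_play_of_strategy]). *)

Definition ceil_div (N m : nat) : nat := (N + m.-1) %/ m.

Definition lower (m N : nat) : nat := N - (if m %| N then m else N %% m).

Section ChocolateStones.

Variable m : nat.
Hypothesis m_gt0 : 0 < m.

(** The two bounds say [N / m <= k < N / m + 1]; written additively they avoid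
    truncated subtraction and cover [N = 0]. *)
Lemma ceil_div_eq N k : (ceil_div N m == k) = (N <= k * m < N + m).
Proof.
rewrite /ceil_div eqn_leq -ltnS ltn_divLR // leq_divRL //; lia.
Qed.

Lemma ceil_div_bounds N : N <= ceil_div N m * m < N + m.
Proof. by rewrite -ceil_div_eq. Qed.

Lemma ceil_div0 : ceil_div 0 m = 0.
Proof. by apply/eqP; rewrite ceil_div_eq. Qed.

Lemma f_ceil_div N : f m N = ceil_div N m.
Proof.
have /andP[leN ltN] := ceil_div_bounds N.
have m_gt0R : (0 < m%:R :> rat)%R by rewrite Num.Theory.ltr0n.
apply: Num.Theory.ceil_def; apply/andP; split.
  rewrite Num.Theory.ltr_pdivlMr // GRing.rmorphB /= GRing.mulrBl GRing.mul1r.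
  by rewrite Num.Theory.ltrBlDr -GRing.natrM -GRing.natrD Num.Theory.ltr_nat.
by rewrite Num.Theory.ler_pdivrMr // -GRing.natrM Num.Theory.ler_nat.
Qed.

Lemma move_ceil_div N N' :
  move m N N' -> ceil_div N m = (ceil_div N' m).+1.
Proof.
move=> /andP[leN'N /andP[N_gt0 removal]].
apply/eqP; rewrite ceil_div_eq mulSn.
have := ceil_div_bounds N'; move: (ceil_div N' m) => k /andP[leN' ltN'].
case: ifPn removal => [_ /eqP|mN /and3P[le_a le_m _]]; first by lia.
have a_gt0 : 0 < N %% m by rewrite lt0n.
have def_N := divn_eq N m.
(* At least [N %% m] stones leave, so [k * m] stays below the next multiple of
   [m] above [N], hence at most at the last one below [N]. *)
have k_le_q : k <= N %/ m.
  by rewrite -ltnS -(ltn_pmul2r m_gt0) mulSn; lia.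
have := leq_mul k_le_q (leqnn m); lia.
Qed.

Lemma move_lower N : 0 < N -> move m N (lower m N).
Proof.
move=> N_gt0; rewrite /move /lower /legal_removal leq_subr N_gt0 /=.
case: (boolP (m %| N)) => [/(dvdn_leq N_gt0) le_mN|_]; first by rewrite subKn.
by rewrite subKn ?leq_mod // leqnn andbT ltnW // ltn_pmod.
Qed.

Lemma terminalE N : terminal m N <-> N = 0.
Proof.
split=> [stuck|-> N']; last by rewrite /move /legal_removal andbF.
by case: (posnP N) => // /move_lower; rewrite (negPf (stuck _)).
Qed.

Lemma legal_lower : legal_strategy m (lower m).
Proof.
move=> N nterm; apply: move_lower; rewrite lt0n.
by apply/eqP => N0; apply: nterm; apply/terminalE.
Qed.

Lemma size_complete_play N p : complete_play m N p -> size p = ceil_div N m.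
Proof.
elim: p N => [|N' p IHp] N [/= play /terminalE end0].
  by rewrite end0 ceil_div0.
have /andP[NN' play'] := play.
by rewrite (move_ceil_div _ _ NN') (IHp N') //; split=> //; apply/terminalE.
Qed.

Lemma winner_complete_play N p : complete_play m N p ->
  winner p = if odd (ceil_div N m) then Next else Previous.
Proof.
by move=> /size_complete_play szp; rewrite /winner /mover szp; case: odd.
Qed.

(** Self-play: the strategy answers for whichever player is to move, so the
    resulting play follows it from the point of view of both. *)
Lemma complete_play_of_strategy sigma N : legal_strategy m sigma ->
  exists2 p, complete_play m N p & fpath sigma N p.
Proof.
move=> legal; have [n] := ubnP N; elim: n N => // n IHn N ltNn.
have [->|N_gt0] := posnP N.
  by exists [::] => //; split=> //; apply/terminalE.
have NsN : move m N (sigma N) by apply: legal => /terminalE N0; lia.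
have /IHn[p [play endp] sigma_p] : sigma N < n.
  by have := move_lt m_gt0 NsN; lia.
by exists (sigma N :: p); [split; rewrite //= NsN | rewrite /= eqxx].
Qed.

Lemma follows_fpath P sigma N p : fpath sigma N p -> follows P sigma N p.
Proof. by move=> /(pathP 0) sigma_p i /sigma_p /eqP. Qed.

Lemma P_positionE N : P_position m N <-> ~~ odd (ceil_div N m).
Proof.
split=> [[sigma [legal wins]]|even_N].
  have [p play sigma_p] := complete_play_of_strategy sigma N legal.
  have := wins p play (follows_fpath _ _ _ _ sigma_p).
  by rewrite (winner_complete_play N p play); case: odd.
exists (lower m); split=> [|p play _]; first exact: legal_lower.
by rewrite (winner_complete_play N p play) (negPf even_N).
Qed.

End ChocolateStones.

Theorem theorem1 (m : nat) (hm : 0 < m) :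
  no_strategy m /\ (forall N : nat, P_position m N <-> (2 %| f m N)%Z).
Proof.
split=> N.
  exists (if odd (ceil_div N m) then Next else Previous) => p.
  exact: winner_complete_play.
by rewrite f_ceil_div // dvdzE dvdn2; apply: P_positionE.
Qed.
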